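(* Let $G$ be a finite group, let $N$ be a normal subgroup of $G$, and let $p$ be a prime. Suppose $\eta\in \mathrm{IBr}(G)$ and $\mathrm{IBr}(G/N)=\{\beta_1,\dots,\beta_n\}$ (the $\beta_i$ being the distinct irreducible $p$-Brauer characters of $G/N$), and suppose that $p\nmid |G/N|$ and that $\beta_1\eta,\dots,\beta_n\eta$ are distinct and irreducible (that is, are distinct elements of $\mathrm{IBr}(G)$). Then $\eta_N$ is an irreducible Brauer character of $N$, i.e. $\eta_N\in\mathrm{IBr}(N)$.
   Context: $\mathrm{IBr}(G)$ denotes the set of irreducible Brauer characters of $G$ with respect to the prime $p$; these are functions on the set of $p$-regular elements of $G$. Brauer characters of $G/N$ are viewed as Brauer characters of $G$ by inflation, so $(\beta\eta)(g)=\beta(gN)\eta(g)$ for $p$-regular $g\in G$. $\eta_N$ denotes the restriction of $\eta$ to the $p$-regular elements of $N$. *)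

(* Defs.v *)
From HB Require Import structures.
From mathcomp Require Import all_boot all_order all_algebra.
From mathcomp Require Import all_fingroup all_solvable all_field all_character.

Set Implicit Arguments.
Unset Strict Implicit.
Unset Printing Implicit Defensive.

Import GroupScope GRing.Theory.
Local Open Scope ring_scope.

(* The ring R of algebraic integers in algC.  Brauer characters are taken     *)
(* with respect to a maximal ideal M of R containing p; the residue map       *)
(* R -> R / M = F is a surjective ring morphism red onto an algebraically     *)
(* closed field F of characteristic p, and conversely the kernel of any such  *)
(* red is such an M.                                                          *)
Record algint := AlgInt { algint_val :> algC; _ : algint_val \in Aint }.

HB.instance Definition _ := [isSub for algint_val].
HB.instance Definition _ := [Choice of algint by <:].
HB.instance Definition _ := [SubChoice_isSubComNzRing of algint by <:].

(* k = 0 is excluded by the first condition. *)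
Definition p'_root_of_unity (p : nat) (z : algint) : Prop :=
  exists2 k : nat, ~~ (p %| k)%N & z ^+ k = 1.

Section Brauer.

Variables (p : nat) (F : closedFieldType) (red : {rmorphism algint -> F}).
Variables (gT : finGroupType) (G : {group gT}).

(* A function on the p-regular elements of G is encoded by its extension by   *)
(* zero to a class function on G.  On p'-roots of unity red is injective, and *)
(* the eigenvalues of rG g all lift to such roots when g is p-regular, so the *)
(* multiset s below exists and is unique.                                     *)
Definition affords_Brauer n (rG : mx_representation F G n) (phi : 'CF(G)) :
    Prop :=
  forall g, g \in G ->
  if p^'.-elt g then
    exists s : seq algint,
      [/\ forall z, z \in s -> p'_root_of_unity p z,
          char_poly (rG g) = \prod_(z <- s) ('X - (red z)%:P)
        & phi g = \sum_(z <- s) (z : algC)]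
  else phi g = 0.

Definition IBr (phi : 'CF(G)) : Prop :=
  exists n (rG : mx_representation F G n),
    mx_irreducible rG /\ affords_Brauer rG phi.

End Brauer.

Arguments IBr p%_N {F} red {gT} G%_G phi%_CF.

(* Main.v *)
Require Import Defs.
From HB Require Import structures.
From mathcomp Require Import all_boot all_order all_algebra.
From mathcomp Require Import all_fingroup all_solvable all_field all_character.

Set Implicit Arguments.
Unset Strict Implicit.
Unset Printing Implicit Defensive.

Import GroupScope GRing.Theory.
Local Open Scope ring_scope.

(** Let V afford eta, put Q = G / N, and let G act on End_F(V) by conjugation;
    N acts trivially on E = End_N(V), so E is a Q-module, semisimple by
    Maschke's theorem since p does not divide #|Q|.

    The claim is that Q acts trivially on E. Otherwise the complement in E of
    the Q-fixed vectors contains a simple Q-module S, affording a Brauer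
    character beta. The product beta * eta is afforded by an irreducible module
    W, and the traces of the inflated tensor product S (x) V and of W agree on
    p-regular elements, hence on all of G (char_poly_constt_p'), because g and
    its p'-part have the same characteristic polynomial in characteristic p.
    A representation with the same degree and trace function as an absolutely
    irreducible one is itself absolutely irreducible (mxtrace_eq_abs_irr), so
    S (x) V is irreducible.
    As S consists of endomorphisms of V, evaluation is a nonzero G-linear map
    from S (x) V to V. It is injective, which forces dim S = 1, and any nonzero
    element of S is then an isomorphism between V and its twist by S; so
    beta * eta = eta = 1 * eta (cent_twist_trivial). Since the products
    beta_i * eta are distinct, beta = 1, so S is trivial, contradicting the
    choice of S.

    Hence End_N(V) = End_G(V), which is F by Schur's lemma. By Clifford's
    theorem the restriction of V to N is semisimple, and a semisimple module
    with scalar endomorphism ring is simple (Clifford_cent_scalar_irr). *)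

(** * Reduction of roots of unity of order prime to p *)

Section RootsOfUnity.

Variables (p : nat) (p_prime : prime p).
Variables (F : closedFieldType) (p_char : p \in [pchar F]).
Variable red : {rmorphism algint -> F}.

Lemma algint_valX (z : algint) k : algint_val (z ^+ k) = (z : algC) ^+ k.
Proof. exact: (rmorphXn (val : algint -> algC)). Qed.

Lemma algint_prim_root k : (0 < k)%N ->
  {w : algint | k.-primitive_root (w : algC)}.
Proof.
move=> k_gt0; have [w prim_w] := C_prim_root_exists k_gt0.
by exists (AlgInt (Aint_prim_root prim_w)).
Qed.

(** Reducing the factorization of X^k - 1 over the algebraic integers. *)
Lemma red_factor_Xn_sub_1 k (w : algint) : k.-primitive_root (w : algC) ->
  \prod_(0 <= i < k) ('X - (red (w ^+ i))%:P) = 'X^k - 1 :> {poly F}.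
Proof.
move=> prim_w.
have alg_eq: \prod_(0 <= i < k) ('X - (w ^+ i)%:P) = 'X^k - 1 :> {poly algint}.
  have [v def_v]: {v : {rmorphism algint -> algC} | v =1 algint_val}.
    by exists (val : {rmorphism algint -> algC}).
  have v_inj: injective (map_poly v).
    apply: map_inj_poly (rmorph0 v) => x y; rewrite !def_v; exact: val_inj.
  apply: v_inj; rewrite rmorph_prod rmorphB /= map_polyXn rmorph1.
  rewrite -(factor_Xn_sub_1 prim_w); apply: eq_bigr => i _.
  by rewrite rmorphB /= map_polyX map_polyC /= def_v algint_valX.
move/(congr1 (map_poly red)): alg_eq.
rewrite rmorph_prod rmorphB /= map_polyXn rmorph1 => <-.
by apply: eq_bigr => i _; rewrite rmorphB /= map_polyX map_polyC.
Qed.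

Lemma p'nat_neq0 k : ~~ (p %| k)%N -> k%:R != 0 :> F.
Proof. by rewrite (dvdn_pcharf p_char). Qed.

(** When p does not divide k, X^k - 1 is separable over F, so red is injective
    on k-th roots of unity. *)
Lemma red_prim_root_inj k (w : algint) : k.-primitive_root (w : algC) ->
  ~~ (p %| k)%N -> {in gtn k &, injective (fun i => red (w ^+ i))}.
Proof.
move=> prim_w p'k.
have: uniq [seq red (w ^+ i) | i <- index_iota 0 k].
  rewrite -separable_prod_XsubC big_map red_factor_Xn_sub_1 //.
  exact/separable_Xn_sub_1/p'nat_neq0.
rewrite /index_iota subn0 => /(uniqP (0 : F)) inj_nth i j lt_ik lt_jk eq_ij.
apply: inj_nth; rewrite ?inE ?size_map ?size_iota //.
by rewrite !(nth_map 0) ?size_iota ?nth_iota.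
Qed.

Lemma p'_root_exp_prim k (w z : algint) : k.-primitive_root (w : algC) ->
  z ^+ k = 1 -> exists2 i, (i < k)%N & z = w ^+ i.
Proof.
move=> prim_w zk1.
have [|i def_z] := prim_rootP prim_w (x := z).
  by rewrite -algint_valX zk1.
by exists i => //; apply: val_inj; rewrite /= algint_valX.
Qed.

Lemma red_p'_root_inj (y z : algint) :
  p'_root_of_unity p y -> p'_root_of_unity p z -> red y = red z -> y = z.
Proof.
move=> [k p'k yk1] [l p'l zl1] eq_yz.
have p'kl: ~~ (p %| k * l)%N by rewrite Euclid_dvdM // negb_or p'k.
have kl_gt0: (0 < k * l)%N by rewrite lt0n; apply: contraNneq p'kl => ->.
have [w prim_w] := algint_prim_root kl_gt0.
have [|i lt_i def_y] := p'_root_exp_prim (z := y) prim_w.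
  by rewrite exprM yk1 expr1n.
have [|j lt_j def_z] := p'_root_exp_prim (z := z) prim_w.
  by rewrite mulnC exprM zl1 expr1n.
rewrite def_y def_z; congr (_ ^+ _).
by apply: (red_prim_root_inj prim_w p'kl) => //; rewrite -def_y -def_z.
Qed.

(** Every k-th root of unity of F lifts along red when p does not divide k. *)
Lemma red_p'_root_lift k : ~~ (p %| k)%N ->
  exists lift : F -> algint,
    forall a, a ^+ k = 1 -> p'_root_of_unity p (lift a) /\ red (lift a) = a.
Proof.
move=> p'k; have k_gt0: (0 < k)%N by rewrite lt0n; apply: contraNneq p'k => ->.
have [w prim_w] := algint_prim_root k_gt0.
have wk1: w ^+ k = 1.
  by apply: val_inj; rewrite /= algint_valX (prim_expr_order prim_w).
exists (fun a => w ^+ find (fun i => red (w ^+ i) == a) (iota 0 k)) => a ak1.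
split; first by exists k; rewrite // exprAC wk1 expr1n.
have: root (\prod_(0 <= i < k) ('X - (red (w ^+ i))%:P)) a.
  by rewrite red_factor_Xn_sub_1 // [root _ _]unity_rootE ak1.
rewrite -(big_map (fun i => red (w ^+ i)) xpredT (fun x => 'X - x%:P)).
rewrite root_prod_XsubC /index_iota subn0 => /mapP[i ki def_a].
have has_a: has (fun i => red (w ^+ i) == a) (iota 0 k).
  by apply/hasP; exists i; rewrite ?def_a.
have := nth_find 0 has_a; rewrite nth_iota => [/eqP //|].
by move: has_a; rewrite has_find size_iota.
Qed.

(** The lifted eigenvalues, hence the value of a Brauer character, are
    determined by the characteristic polynomial. *)
Lemma p'_roots_sum_eq (s t : seq algint) :
  (forall z, z \in s -> p'_root_of_unity p z) ->
  (forall z, z \in t -> p'_root_of_unity p z) ->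
  \prod_(z <- s) ('X - (red z)%:P) = \prod_(z <- t) ('X - (red z)%:P) ->
  \sum_(z <- s) (z : algC) = \sum_(z <- t) (z : algC).
Proof.
move=> p's p't eq_st.
suffices: perm_eq s t by apply: perm_big.
have{eq_st}: perm_eq (map red s) (map red t).
  by apply: prod_XsubC_eq; rewrite !big_map.
elim: s t p's p't => [|z s IHs] t p's p't eq_st.
  have: size t = 0%N by rewrite -(size_map red) -(perm_size eq_st).
  by move=> /size0nil->.
have: red z \in map red t by rewrite -(perm_mem eq_st) mem_head.
case/mapP=> y ty eq_zy.
have def_z: z = y.
  by apply: red_p'_root_inj eq_zy; [apply/p's/mem_head | apply: p't].
have eq_t := perm_to_rem ty.
rewrite def_z perm_sym (permPl eq_t) perm_cons perm_sym.
apply: IHs => [x sx|x /mem_rem|].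
- by apply: p's; rewrite inE sx orbT.
- exact: p't.
rewrite -(perm_cons (red z)) {2}def_z; apply: perm_trans eq_st _.
exact: perm_map eq_t.
Qed.

End RootsOfUnity.

(** * Traces and irreducibility of matrix representations *)

Section CharPolyFrobenius.

Variables (p : nat) (F : fieldType) (p_char : p \in [pchar F]).

(** In characteristic p, det(X - A)^q = det(X^q - A^q) for q = p ^ m, since X
    and A commute; and q-th powers are injective on polynomials. *)
Lemma char_poly_pexp_eq n (A B : 'M[F]_n.+1) m :
  A ^+ (p ^ m) = B ^+ (p ^ m) -> char_poly A = char_poly B.
Proof.
have p_charP: p \in [pchar {poly F}] by rewrite pchar_poly.
have p_charM: p \in [pchar 'M[{poly F}]_n.+1].
  rewrite inE (pcharf_prime p_charP) -[1]/(1%:M) -raddfMn.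
  by rewrite (pcharf0 p_charP) raddf0 /=.
have FrobM k (C : 'M[F]_n.+1) : char_poly_mx C ^+ (p ^ k)
    = 'X%:M ^+ (p ^ k) - map_mx (@polyC F) C ^+ (p ^ k).
  elim: k => [|k IHk]; first by rewrite !expr1.
  rewrite expnSr !exprM {}IHk -!(pFrobenius_autE p_charM).
  rewrite pFrobenius_autB_comm //; apply: commrX; apply/commr_sym/commrX.
  exact: scalar_mxC.
have FrobP k : injective (fun q : {poly F} => q ^+ (p ^ k)).
  elim: k => [|k IHk] q r; rewrite /= ?expr1 // expnSr !exprM.
  rewrite -!(pFrobenius_autE p_charP) => eq_qr; apply/IHk/eqP.
  have: pFrobenius_aut p_charP (q ^+ (p ^ k) - r ^+ (p ^ k)) == 0.
    by rewrite pFrobenius_autB_comm ?eq_qr ?subrr //; apply: mulrC.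
  by rewrite pFrobenius_autE expf_eq0 subr_eq0 => /andP[].
move=> eq_AB; apply: (FrobP m).
have detX k (M : 'M[{poly F}]_n.+1) : \det (M ^+ k) = \det M ^+ k.
  by elim: k => [|k IHk]; rewrite ?det1 // !exprS -IHk det_mulmx.
rewrite /= /char_poly -!detX !FrobM; congr (\det (_ - _)).
by rewrite -!rmorphXn eq_AB.
Qed.

Lemma char_poly_constt_p' (gT : finGroupType) (G : {group gT}) n
    (rG : mx_representation F G n) g :
  g \in G -> char_poly (rG g) = char_poly (rG g.`_p^').
Proof.
case: n rG => [|n] rG Gg; first by rewrite [rG _]flatmx0 [rG g.`_ _]flatmx0.
have Gg' : g.`_p^' \in G by rewrite groupX.
apply: (@char_poly_pexp_eq _ _ _ (logn p #[g])).
rewrite -!repr_mxX //; congr (rG _).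
have p_pr := pcharf_prime p_char.
rewrite -p_part -{1}(consttC p g) expgMn; last exact: commuteX2.
by rewrite -order_constt expg_order mul1g.
Qed.

End CharPolyFrobenius.

Lemma char_poly_intertwine (F : fieldType) n (A B P : 'M[F]_n) :
  P \in unitmx -> A *m P = P *m B -> char_poly A = char_poly B.
Proof.
move=> uP eqAB; pose cP := map_mx (@polyC F) P.
have nz_cP: \det cP != 0.
  by rewrite det_map_mx polyC_eq0 -unitfE -unitmxE.
apply: (mulIf nz_cP); rewrite [RHS]mulrC -!det_mulmx; congr (\det _).
by rewrite mulmxBl mulmxBr -!map_mxM eqAB scalar_mxC.
Qed.

Section ClosedField.

Variables (F : closedFieldType) (gT : finGroupType) (G : {group gT}).

(** Schur's lemma over an algebraically closed field. *)
Lemma closed_cent_scalar n (rG : mx_representation F G n) (A : 'M_n) :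
  mx_irreducible rG -> centgmx rG A -> is_scalar_mx A.
Proof.
move=> irrG cGA; have [n_gt0 _] := (mx_irrP rG).1 irrG.
have: size (char_poly A) != 1%N by rewrite size_char_poly eqSS -lt0n.
case/closed_rootP=> a root_a.
have [] := boolP (A - a%:M == 0) => [|nzAa].
  by rewrite subr_eq0 => /eqP->; apply: scalar_mx_is_scalar.
have: A - a%:M \in unitmx.
  apply: mx_Schur irrG _ _ nzAa; apply/centgmxP=> x Gx.
  by rewrite mulmxBl mulmxBr (centgmxP cGA) // scalar_mxC.
have: eigenvalue A a by rewrite eigenvalue_root_char.
case/eigenvalueP=> v def_v nz_v /mulmxK/(_ v).
rewrite mulmxBr def_v mul_mx_scalar subrr mul0mx => v0.
by rewrite -v0 eqxx in nz_v.
Qed.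

Lemma closed_abs_irr n (rG : mx_representation F G n) :
  mx_irreducible rG -> mx_absolutely_irreducible rG.
Proof.
move=> irrG; apply: cent_mx_scalar_abs_irr => //; rewrite leqNgt.
apply/(has_non_scalar_mxP (scalar_mx_cent _ _)) => [[A]].
by rewrite memmx_cent_envelop => /(closed_cent_scalar irrG)->.
Qed.

End ClosedField.

(** The trace form on square matrices is nondegenerate. *)
Lemma mxtrace_nondegenerate (R : comNzRingType) n (A : 'M[R]_n) :
  (forall B : 'M[R]_n, \tr (A *m B) = 0) -> A = 0.
Proof.
move=> trA0; apply/matrixP=> i j; rewrite mxE -(trA0 (delta_mx j i)).
rewrite /mxtrace (bigD1 i) //= big1 ?addr0 => [|k ne_ki].
  rewrite mxE (bigD1 j) //= big1 ?addr0 ?mxE ?eqxx ?mulr1 // => k ne_kj.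
  by rewrite mxE (negPf ne_kj) mulr0.
by rewrite mxE big1 // => l _; rewrite mxE (negPf ne_ki) andbF mulr0.
Qed.

(** If a combination of the rG g vanishes, the trace form is zero between the
    same combination of the rW g and the span of the rW g, i.e., all matrices;
    so it vanishes as well. Thus the image of the group algebra under rG is at
    least as large as that under rW. *)
Lemma mxtrace_eq_abs_irr (F : fieldType) (gT : finGroupType) (G : {group gT}) n
    (rG rW : mx_representation F G n) :
    mx_absolutely_irreducible rW ->
    {in G, forall g, \tr (rG g) = \tr (rW g)} ->
  mx_absolutely_irreducible rG.
Proof.
rewrite /mx_absolutely_irreducible => /andP[-> fullW] eq_tr /=.
set EG := enveloping_algebra_mx rG; set EW := enveloping_algebra_mx rW in fullW.
have defE (r : mx_representation F G n) (u : 'rV_#|G|) :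
    vec_mx (u *m enveloping_algebra_mx r)
      = \sum_i u 0 i *: r (enum_val i) :> 'M_n.
  rewrite mulmx_sum_row linear_sum; apply: eq_bigr => i _.
  by rewrite linearZ rowK /= mxvecK.
have sub_ker: (kermx EG <= kermx EW)%MS.
  apply/rV_subP=> u /sub_kermxP uG0; apply/sub_kermxP.
  apply: (can_inj vec_mxK); rewrite linear0; apply: mxtrace_nondegenerate => B.
  have: (mxvec B <= EW)%MS by rewrite submx_full.
  case/submxP=> w /(congr1 vec_mx); rewrite mxvecK => ->; rewrite !defE.
  have tr_h h : h \in G -> \tr ((\sum_i u 0 i *: rW (enum_val i)) *m rW h) = 0.
    move=> Gh; have /(congr1 (fun M => \tr (M *m rG h))) := defE rG u.
    rewrite uG0 linear0 mul0mx mxtrace0 => /esym tr0; rewrite -[RHS]tr0.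
    rewrite !mulmx_suml !linear_sum /=; apply: eq_bigr => i _.
    rewrite -!scalemxAl !mxtraceZ.
    by rewrite -!repr_mxM ?enum_valP // eq_tr ?groupM ?enum_valP.
  rewrite mulmx_sumr linear_sum big1 // => i _.
  by rewrite -scalemxAr /= mxtraceZ tr_h ?mulr0 ?enum_valP.
have := mxrankS sub_ker; rewrite !mxrank_ker /row_full.
rewrite leq_sub2lE ?rank_leq_row // => leWG.
rewrite eqn_leq rank_leq_col; apply: leq_trans leWG.
by rewrite (eqP fullW).
Qed.

Lemma mxtrace_constt_p' p (F : fieldType) (p_char : p \in [pchar F])
    (gT : finGroupType) (G : {group gT}) n (rG : mx_representation F G n) g :
  g \in G -> \tr (rG g) = \tr (rG g.`_p^').
Proof.
move=> Gg; have [n0 | n_gt0] := posnP n.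
  by rewrite /mxtrace; move: rG; rewrite n0 => rG; rewrite !big_ord0.
apply: oppr_inj; rewrite -!char_poly_trace //.
by rewrite (char_poly_constt_p' p_char).
Qed.

(** The projection onto a submodule along a complement is an endomorphism; if
    it is scalar, the submodule is zero or everything. *)
Lemma cent_scalar_irr (F : fieldType) (gT : finGroupType) (G : {group gT}) n
    (rG : mx_representation F G n) :
    (n > 0)%N -> mx_completely_reducible rG 1%:M ->
    (forall A, centgmx rG A -> is_scalar_mx A) ->
  mx_irreducible rG.
Proof.
move=> n_gt0 redG scalG; apply/mx_irrP; split=> // U modU nzU.
have [W modW defUW dxUW] := redG U modU (submx1 U).
have /mxdirect_addsP dx := dxUW.
have: centgmx rG (proj_mx U W).
  by rewrite -row_full_dom_hom -sub1mx -defUW proj_mx_hom.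
case/scalG/is_scalar_mxP=> a def_proj.
have := proj_mx_id dx (submx_refl U); rewrite def_proj mul_mx_scalar => aU.
have nz_a: a != 0 by apply: contraNneq nzU => a0; rewrite -aU a0 scale0r.
have := proj_mx_sub U W 1%:M; rewrite def_proj mul1mx -scalemx1 => sub.
by rewrite -sub1mx; move: sub; rewrite eqmx_scale.
Qed.

Lemma Clifford_cent_scalar_irr (F : fieldType) (gT : finGroupType)
    (G N : {group gT}) (nsNG : N <| G) n (rG : mx_representation F G n) :
    mx_irreducible rG ->
    (forall A, centgmx (subg_repr rG (normal_sub nsNG)) A -> is_scalar_mx A) ->
  mx_irreducible (subg_repr rG (normal_sub nsNG)).
Proof.
set rN := subg_repr _ _ => irrG scalN; have [n_gt0 _] := (mx_irrP rG).1 irrG.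
apply/mx_irrP; split=> // U modU nzU.
have nz1: (1%:M : 'M[F]_n) != 0 by case: irrG.
(* The goal is boolean, so a simple submodule may be assumed to exist. *)
apply: (mxsimple_exists (mxmodule1 rN) nz1) => [[M simM _]].
have [X /subsetP sXG [def1 _]] := Clifford_basis irrG simM.
have redN: mx_completely_reducible rN 1%:M.
  apply: mxsemisimple_reducible; apply: (intro_mxsemisimple def1) => x Xx _.
  by apply: Clifford_simple => //; apply: sXG.
by apply: ((mx_irrP rN).1 (cent_scalar_irr n_gt0 redN scalN)).2.
Qed.

(** A nonzero homomorphism out of an irreducible module is injective. *)
Lemma irr_hom_row_free (F : fieldType) (gT : finGroupType) (G : {group gT}) m n
    (rT : mx_representation F G m) (rG : mx_representation F G n)
    (P : 'M_(m, n)) :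
    mx_irreducible rT -> P != 0 ->
    {in G, forall g, rT g *m P = P *m rG g} ->
  row_free P.
Proof.
move=> irrT nzP homP; rewrite -kermx_eq0; apply: contraNT nzP => nz_ker.
have /sub_kermxP: (1%:M <= kermx P)%MS.
  rewrite sub1mx; apply: ((mx_irrP rT).1 irrT).2 => //.
  apply/mxmoduleP=> g Gg; apply/sub_kermxP.
  by rewrite -mulmxA homP // mulmxA mulmx_ker mul0mx.
by rewrite mul1mx => ->.
Qed.

(** * Brauer characters afforded by a representation *)

Section BrauerCharacters.

Variables (p : nat) (p_prime : prime p).
Variables (F : closedFieldType) (p_char : p \in [pchar F]).
Variable red : {rmorphism algint -> F}.

Lemma algint_val_sum (s : seq algint) :
  algint_val (\sum_(z <- s) z) = \sum_(z <- s) (z : algC).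
Proof. exact: (raddf_sum (val : algint -> algC)). Qed.

Lemma p'root1 : p'_root_of_unity p 1.
Proof. by exists 1%N; rewrite ?expr1n // Euclid_dvd1. Qed.

Lemma char_poly_prod_size n (A : 'M[F]_n) (s : seq algint) :
  char_poly A = \prod_(z <- s) ('X - (red z)%:P) -> size s = n.
Proof.
move/(congr1 (fun q : {poly F} => size q)).
by rewrite size_char_poly -(big_map red xpredT (fun a => 'X - a%:P))
           size_prod_XsubC size_map => -[].
Qed.

Lemma char_poly_prod_trace n (A : 'M[F]_n) (s : seq algint) :
  char_poly A = \prod_(z <- s) ('X - (red z)%:P) ->
  \tr A = red (\sum_(z <- s) z).
Proof.
move=> def_A; have sz_s := char_poly_prod_size def_A.
have [n0 | n_gt0] := posnP n.
  have -> : s = [::] by apply: size0nil; rewrite sz_s.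
  by rewrite big_nil rmorph0; move: A {def_A sz_s}; rewrite n0 => A;
     rewrite [A]flatmx0 mxtrace0.
apply: oppr_inj; rewrite -char_poly_trace // def_A rmorph_sum /=.
rewrite -(big_map red xpredT (fun a => 'X - a%:P)) -(big_map red xpredT id) /=.
rewrite -{1}sz_s -(size_map red) coefPn_prod_XsubC //.
by rewrite size_map sz_s -lt0n.
Qed.

Section Afforded.

Variables (gT : finGroupType) (G : {group gT}).

(** The Brauer character reduces to the trace on p-regular elements. *)
Lemma affords_Brauer_trace n (rG : mx_representation F G n) phi g :
    affords_Brauer p red rG phi -> g \in G -> p^'.-elt g ->
  exists2 z : algint, red z = \tr (rG g) & phi g = z.
Proof.
move=> aff Gg p'g; have := aff g Gg; rewrite p'g => -[s [_ def_s ->]].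
exists (\sum_(z <- s) z); first by rewrite (char_poly_prod_trace def_s).
by rewrite algint_val_sum.
Qed.

Lemma affords_Brauer1 n (rG : mx_representation F G n) phi :
  affords_Brauer p red rG phi -> phi 1%g = n%:R.
Proof.
move=> aff; have := aff 1%g (group1 G).
rewrite /p_elt order1 => -[s [p's def_s ->]].
have sz_s := char_poly_prod_size def_s.
have n1: char_poly (rG 1%g)
       = \prod_(z <- nseq n (1 : algint)) ('X - (red z)%:P).
  rewrite repr_mx1 char_poly_trig ?scalar_mx_is_trig //.
  rewrite big_nseq -big_const_ord /=.
  by apply: eq_bigr => i _; rewrite mxE eqxx (rmorph1 red).
have -> : \sum_(z <- s) (z : algC) = \sum_(z <- nseq n (1 : algint)) (z : algC).
  apply: (p'_roots_sum_eq p_prime p_char (red := red) p's).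
    by move=> z /nseqP[-> _]; apply: p'root1.
  by rewrite -def_s.
by rewrite big_nseq -Monoid.iteropE.
Qed.

Lemma affords_Brauer_eq n m (rG : mx_representation F G n)
    (rH : mx_representation F G m) phi psi :
    affords_Brauer p red rG phi -> affords_Brauer p red rH psi ->
    {in G, forall g, char_poly (rG g) = char_poly (rH g)} ->
  phi = psi.
Proof.
move=> aff_phi aff_psi eq_char; apply/cfun_inP => g Gg.
have:= aff_phi g Gg; have := aff_psi g Gg; case: ifP => [_|_ -> -> //].
case=> t [p't def_t ->] [s [p's def_s ->]].
by apply: (p'_roots_sum_eq p_prime p_char (red := red)) => //;
   rewrite -def_s -def_t eq_char.
Qed.

(** For a p'-group every element is p-regular, and its eigenvalues are #|G|-th
    roots of unity, which lift; the Brauer character is a class function because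
    it is computed from the characteristic polynomial. *)
Lemma affords_Brauer_exists n (rG : mx_representation F G n) :
  p^'.-group G -> exists phi : 'CF(G), affords_Brauer p red rG phi.
Proof.
move=> p'G; have p'nG: ~~ (p %| #|G|)%N by rewrite -p'natE.
pose rts (q : {poly F}) := sval (closed_field_poly_normal q).
have def_rts g :
  char_poly (rG g) = \prod_(a <- rts (char_poly (rG g))) ('X - a%:P).
  rewrite /rts; case: closed_field_poly_normal => r /= def_r.
  by rewrite {1}def_r (monicP (char_poly_monic _)) scale1r.
have rts_unity g a : g \in G -> a \in rts (char_poly (rG g)) -> a ^+ #|G| = 1.
  move=> Gg; rewrite -root_prod_XsubC -def_rts -eigenvalue_root_char.
  case/eigenvalueP=> v def_v nz_v; apply/eqP; rewrite -subr_eq0.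
  have: v *m rG (g ^+ #|G|)%g = a ^+ #|G| *: v.
    elim: #|G| => [|k IHk]; first by rewrite repr_mx1 mulmx1 scale1r.
    rewrite expgSr repr_mxM ?groupX // mulmxA IHk -scalemxAl def_v.
    by rewrite scalerA exprSr.
  rewrite expg_cardG // repr_mx1 mulmx1 => /eqP.
  rewrite eq_sym -subr_eq0 -[X in _ - X]scale1r -scalerBl scaler_eq0.
  by rewrite (negPf nz_v) orbF.
have [lift liftP] := red_p'_root_lift red p'nG.
pose f g : algC := \sum_(a <- rts (char_poly (rG g))) (lift a : algC).
have char_J g x :
  g \in G -> x \in G -> char_poly (rG (g ^ x)%g) = char_poly (rG g).
  move=> Gg Gx; apply: (char_poly_intertwine (repr_mx_unit rG (groupVr Gx))).
  by rewrite -!repr_mxM ?groupJ ?groupV // conjgE mulgA mulgK.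
have clsf: is_class_fun <<G>> [ffun g => f g *+ (g \in G)].
  apply: intro_class_fun => [g x | g]; rewrite /= genGid; last by move/negPf->.
  move=> Gg Gx.
  by rewrite groupJr // Gg /f char_J.
exists (Cfun 0 clsf) => g Gg; rewrite (mem_p_elt p'G) // cfunE Gg mulr1n.
exists [seq lift a | a <- rts (char_poly (rG g))]; split.
- by move=> _ /mapP[a /(rts_unity g a Gg)/liftP[p'a _] ->].
- rewrite big_map {1}def_rts; apply: eq_big_seq => a.
  by case/(rts_unity g a Gg)/liftP=> _ ->.
- by rewrite big_map.
Qed.

Lemma affords_cfun1_trivial (rG : mx_representation F G 1) g :
    affords_Brauer p red rG 1 -> g \in G -> p^'.-elt g ->
  rG g = 1%:M.
Proof.
move=> aff Gg p'g; have [z tr_z] := affords_Brauer_trace aff Gg p'g.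
rewrite cfun1E Gg => def_z; rewrite [rG g]mx11_scalar -trace_mx11 -tr_z.
suffices ->: z = 1 by rewrite rmorph1.
by apply: val_inj; rewrite -[LHS]def_z.
Qed.

End Afforded.
End BrauerCharacters.

Lemma triv_mx_repr1 (F : fieldType) (gT : finGroupType) (H : {set gT}) :
  mx_repr H (fun _ => 1%:M : 'M[F]_1).
Proof. by split=> // x y _ _; rewrite mulmx1. Qed.

Lemma IBr_cfun1 p (p_prime : prime p) (F : closedFieldType)
    (red : {rmorphism algint -> F}) (gT : finGroupType) (G : {group gT}) :
  p^'.-group G -> IBr p red G 1.
Proof.
move=> p'G; exists 1%N, (MxRepresentation (triv_mx_repr1 F G)); split.
  exact/mx_abs_irrW/linear_mx_abs_irr.
move=> g Gg; rewrite cfun1E Gg (mem_p_elt p'G) //.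
exists [:: 1]; split.
- by move=> z; rewrite inE => /eqP->; apply: p'root1.
- rewrite big_seq1 (rmorph1 red) /= char_poly_trig ?scalar_mx_is_trig //.
  by rewrite big_ord1 mxE eqxx.
- by rewrite big_seq1.
Qed.

(** * Tensor products and the conjugation module *)

Section Tensor.

Variable F : fieldType.

(** The tensor (Kronecker) product of A and B, acting on row vectors of length
    m * n seen, through mxvec, as m x n matrices X, by X |-> A^T X B; the
    elementary tensor of u and v is u^T v. *)
Definition tensmx m n (A : 'M[F]_m) (B : 'M[F]_n) : 'M[F]_(m * n) :=
  lin_mx (mulmxr B \o mulmx A^T).

Lemma mul_vec_tensmx m n (A : 'M[F]_m) (B : 'M[F]_n) (X : 'M_(m, n)) :
  mxvec X *m tensmx A B = mxvec (A^T *m X *m B).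
Proof. by rewrite mul_vec_lin. Qed.

Lemma eq_mx_mxvec m n k (M P : 'M[F]_(m * n, k)) :
  (forall X, mxvec X *m M = mxvec X *m P) -> M = P.
Proof.
move=> eqMP; apply/row_matrixP=> i; rewrite !rowE.
by rewrite -[delta_mx 0 i]vec_mxK eqMP.
Qed.

Lemma mxtrace_tensmx m n (A : 'M[F]_m) (B : 'M[F]_n) :
  \tr (tensmx A B) = \tr A * \tr B.
Proof.
rewrite /mxtrace; transitivity
  (\sum_i \sum_j tensmx A B (mxvec_index i j) (mxvec_index i j)).
  rewrite pair_bigA (reindex _ (curry_mxvec_bij m n)) /=.
  by apply: eq_bigr => -[i j] _.
rewrite mulr_suml; apply: eq_bigr => i _; rewrite mulr_sumr.
apply: eq_bigr => j _.
have ->: tensmx A B (mxvec_index i j) (mxvec_index i j)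
       = (mxvec (delta_mx i j) *m tensmx A B) 0 (mxvec_index i j).
  by rewrite mxvec_delta -rowE [RHS]mxE.
rewrite mul_vec_tensmx mxvecE -(mul_delta_mx (0 : 'I_1)) mulmxA -colE.
by rewrite -mulmxA -rowE mxE big_ord1 !mxE.
Qed.

Section Representations.

Variables (gT : finGroupType) (G : {group gT}).

Lemma tens_mx_repr m n (rS : mx_representation F G m)
    (rG : mx_representation F G n) :
  mx_repr G (fun g => tensmx (rS g) (rG g)).
Proof.
split=> [|x y Gx Gy]; apply: eq_mx_mxvec => X.
  by rewrite mul_vec_tensmx !repr_mx1 trmx1 mul1mx !mulmx1.
by rewrite mulmxA !mul_vec_tensmx !repr_mxM // trmx_mul !mulmxA.
Qed.

Definition tens_repr m n (rS : mx_representation F G m)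
    (rG : mx_representation F G n) : mx_representation F G (m * n) :=
  MxRepresentation (tens_mx_repr rS rG).

Lemma dual_mx_repr n (rG : mx_representation F G n) :
  mx_repr G (fun g => (rG g^-1%g)^T).
Proof.
split=> [|x y Gx Gy]; first by rewrite invg1 repr_mx1 trmx1.
by rewrite invMg repr_mxM ?groupV // trmx_mul.
Qed.

Definition dual_repr n (rG : mx_representation F G n) :=
  MxRepresentation (dual_mx_repr rG).

(** The action of G on End(V), seen as the tensor product of the dual of V with
    V: g maps X to g^-1 X g. *)
Definition conj_repr n (rG : mx_representation F G n) :=
  tens_repr (dual_repr rG) rG.

End Representations.

Lemma mul_vec_conj_repr (gT : finGroupType) (G : {group gT}) n
    (rG : mx_representation F G n) (X : 'M_n) g :
  mxvec X *m conj_repr rG g = mxvec (rG g^-1%g *m X *m rG g).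
Proof. by rewrite mul_vec_tensmx trmxK. Qed.

Lemma mxvec_conj_fixP (gT : finGroupType) (G : {group gT}) n
    (rG : mx_representation F G n) (X : 'M_n) g : g \in G ->
  (mxvec X *m conj_repr rG g = mxvec X) <-> (X *m rG g = rG g *m X).
Proof.
move=> Gg; rewrite mul_vec_conj_repr; split=> [/(can_inj mxvecK) eqX | eqX].
  by rewrite -{2}eqX !mulmxA -repr_mxM ?groupV // mulgV repr_mx1 mul1mx.
by rewrite -mulmxA eqX mulmxA -repr_mxM ?groupV // mulVg repr_mx1 mul1mx.
Qed.

Section Evaluation.

Variables (m n : nat) (B : 'M[F]_(m, n * n)).

(** The rows of B span a space of endomorphisms of F^n; the evaluation map sends
    the tensor product of the k-th basis vector and v to v B_k, where B_k is the
    k-th row of B read as an n x n matrix. *)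
Definition eval_tens (X : 'M[F]_(m, n)) : 'rV[F]_n :=
  \sum_k row k X *m vec_mx (row k B).

Fact eval_tens_linear : linear eval_tens.
Proof.
move=> c X Y; rewrite scaler_sumr -big_split; apply: eq_bigr => k _ /=.
by rewrite linearP mulmxDl scalemxAl.
Qed.

HB.instance Definition _ :=
  GRing.isLinear.Build F 'M[F]_(m, n) 'rV[F]_n _ eval_tens eval_tens_linear.

(** The matrix of the evaluation map. *)
Definition eval_mx : 'M[F]_(m * n, n) := lin1_mx (eval_tens \o vec_mx).

Lemma mul_vec_eval_mx (X : 'M[F]_(m, n)) : mxvec X *m eval_mx = eval_tens X.
Proof. by rewrite mul_rV_lin1 /= mxvecK. Qed.

Lemma eval_mx_neq0 : B != 0 -> eval_mx != 0.
Proof.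
apply: contraNneq => ev0; apply/eqP/row_matrixP=> k; rewrite row0.
apply: (can_inj vec_mxK); rewrite linear0; apply/row_matrixP=> i.
have := mul_vec_eval_mx (delta_mx k i); rewrite ev0 mulmx0 => ev_ki.
rewrite row0 [RHS]ev_ki /eval_tens (bigD1 k) //= big1 ?addr0 => [|l ne_lk].
  by rewrite [row k (delta_mx k i)]rowE mul_delta_mx -rowE.
by rewrite rowE mul_delta_mx_0 ?mul0mx.
Qed.

(** If B intertwines S with conjugation, evaluation is equivariant:
    (v g) (g^-1 B_k g) = (v B_k) g. *)
Lemma eval_mx_hom (gT : finGroupType) (G : {group gT})
    (rG : mx_representation F G n) (S : 'M_m) g :
    g \in G -> S *m B = B *m conj_repr rG g ->
  tensmx S (rG g) *m eval_mx = eval_mx *m rG g.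
Proof.
move=> Gg eqSB; apply: eq_mx_mxvec => X.
rewrite !mulmxA mul_vec_tensmx !mul_vec_eval_mx /eval_tens mulmx_suml.
have defB l : \sum_k S l k *: vec_mx (row k B)
            = rG g^-1%g *m vec_mx (row l B) *m rG g.
  apply: (can_inj mxvecK); rewrite -mul_vec_conj_repr vec_mxK -row_mul -eqSB.
  rewrite row_mul mulmx_sum_row linear_sum; apply: eq_bigr => k _.
  by rewrite linearZ /= vec_mxK mxE.
(* Expanding the left-hand side over the rows of X g. *)
transitivity (\sum_l row l X *m rG g *m (\sum_k S l k *: vec_mx (row k B))).
  transitivity (\sum_k \sum_l S l k *: (row l X *m rG g *m vec_mx (row k B))).
    apply: eq_bigr => k _; rewrite -mulmxA row_mul.
    rewrite [row k S^T *m _]mulmx_sum_row mulmx_suml.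
    by apply: eq_bigr => l _; rewrite row_mul -scalemxAl [row k _ 0 l]mxE mxE.
  rewrite exchange_big; apply: eq_bigr => l _; rewrite mulmx_sumr.
  by apply: eq_bigr => k _; rewrite scalemxAr.
apply: eq_bigr => l _; rewrite defB !mulmxA.
rewrite -[_ *m rG g *m rG _]mulmxA -repr_mxM ?groupV // mulgV repr_mx1.
by rewrite mulmx1.
Qed.

End Evaluation.

End Tensor.

(** * Twisting by Brauer characters of the quotient *)

(** Substituting c X for X in det(X - c A) gives c^n det(X - A). *)
Lemma char_poly_scale (F : fieldType) n (A : 'M[F]_n) c (s : seq F) :
    c != 0 -> char_poly A = \prod_(a <- s) ('X - a%:P) ->
  char_poly (c *: A) = \prod_(a <- s) ('X - (c * a)%:P).
Proof.
move=> nz_c def_A.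
have sz_s: size s = n.
  have := congr1 (fun q : {poly F} => size q) def_A.
  by rewrite size_char_poly size_prod_XsubC => -[].
have comp_inj: injective (comp_poly (c *: 'X)).
  move=> q r /(congr1 (comp_poly (c^-1 *: 'X))); rewrite -!comp_polyA.
  by rewrite comp_polyZ comp_polyX scalerA mulfV // scale1r !comp_polyXr.
apply: comp_inj; rewrite rmorph_prod -det_map_mx.
have ->: map_mx (comp_poly (c *: 'X)) (char_poly_mx (c *: A))
       = c%:P *: char_poly_mx A.
  apply/matrixP=> i j; rewrite !mxE rmorphB rmorphMn /= comp_polyX comp_polyC.
  by rewrite mulrBr -polyCM mulrnAr mul_polyC.
rewrite detZ -/(char_poly A) def_A -sz_s.
elim: (s) => [|a t IHt]; first by rewrite !big_nil mul1r.
rewrite !big_cons -IHt /= exprS mulrACA; congr (_ * _).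
by rewrite comp_polyB comp_polyX comp_polyC polyCM mulrBr !mul_polyC.
Qed.

Section InflatedTensor.

Variables (p : nat) (p_prime : prime p).
Variables (F : closedFieldType) (p_char : p \in [pchar F]).
Variable red : {rmorphism algint -> F}.
Variables (gT : finGroupType) (G N : {group gT}) (nsNG : N <| G).

(** Inflation to G of a representation of G / N. *)
Definition infl_repr m (rS : mx_representation F (G / N) m) :
  mx_representation F G m := morphim_repr rS (normal_norm nsNG).

Lemma infl_reprE m (rS : mx_representation F (G / N) m) g :
  infl_repr rS g = rS (coset N g).
Proof. by []. Qed.

(** If the product of the Brauer characters is irreducible, so is the tensor
    product of the modules. *)
Lemma tens_Brauer_abs_irr m n k (rS : mx_representation F (G / N) m)
    (rG : mx_representation F G n) (rW : mx_representation F G k) beta eta :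
    affords_Brauer p red rS beta -> affords_Brauer p red rG eta ->
    mx_irreducible rW -> affords_Brauer p red rW ((beta %% N)%CF * eta) ->
  mx_absolutely_irreducible (tens_repr (infl_repr rS) rG).
Proof.
move=> aff_beta aff_eta irrW affW.
(* The degrees agree: both are the value at 1 of beta * eta. *)
have def_k: (m * n)%N = k.
  apply/eqP; rewrite -(Num.Theory.eqr_nat algC) natrM.
  rewrite -(affords_Brauer1 p_prime p_char affW).
  rewrite -(affords_Brauer1 p_prime p_char aff_beta).
  by rewrite -(affords_Brauer1 p_prime p_char aff_eta) cfunE cfMod1.
move: rW irrW affW; rewrite -{}def_k => rW irrW affW.
apply: mxtrace_eq_abs_irr (closed_abs_irr irrW) _ => g Gg.
rewrite (mxtrace_constt_p' p_char) // [RHS](mxtrace_constt_p' p_char) //.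
have p'h: p^'.-elt g.`_p^' by apply: p_elt_constt.
have: g.`_p^' \in G by rewrite groupX.
move: (g.`_p^') p'h => h p'h Gh {g Gg}.
have Qh : coset N h \in (G / N)%g by apply: mem_quotient.
have p'Nh : p^'.-elt (coset N h).
  by apply: morph_p_elt p'h; apply: (subsetP (normal_norm nsNG)).
(* red z1 = red (z2 * z3) because z1 = z2 * z3 already in algC. *)
have [z1 <- def1] := affords_Brauer_trace affW Gh p'h.
have [z2 tr2 def2] := affords_Brauer_trace aff_beta Qh p'Nh.
have [z3 tr3 def3] := affords_Brauer_trace aff_eta Gh p'h.
rewrite /= mxtrace_tensmx -tr3 infl_reprE -tr2.
rewrite -rmorphM; congr (red _); apply: val_inj.
by rewrite /= -def1 cfunE cfModE // def2 def3.
Qed.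

(** Twisting by a linear representation multiplies all eigenvalues of rG g by
    the same scalar; if the characteristic polynomials are unchanged, so is the
    Brauer character. *)
Lemma linear_scale_affords n (rS : mx_representation F (G / N) 1)
    (rG : mx_representation F G n) beta eta :
    affords_Brauer p red rS beta -> affords_Brauer p red rG eta ->
    {in G, forall g,
      char_poly (rS (coset N g) 0 0 *: rG g) = char_poly (rG g)} ->
  (beta %% N)%CF * eta = eta.
Proof.
move=> aff_beta aff_eta eq_char; apply/cfun_inP=> g Gg.
rewrite cfunE cfModE //.
have := aff_eta g Gg; case: ifP => [p'g | _ ->]; last by rewrite mulr0.
have Qg : coset N g \in (G / N)%g by apply: mem_quotient.
have p'Ng : p^'.-elt (coset N g).
  by apply: morph_p_elt p'g; apply: (subsetP (normal_norm nsNG)).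
have := aff_beta _ Qg; rewrite p'Ng => -[s1 [p's1 def_s1 ->]].
case=> s [p's def_s ->].
have tr1 := char_poly_prod_trace def_s1.
have sz1 := char_poly_prod_size def_s1.
case: s1 sz1 p's1 def_s1 tr1 => // z1 [] // _ p's1 def_s1 tr1.
rewrite big_seq1 mulr_sumr.
have p'z1: p'_root_of_unity p z1 by apply: p's1; rewrite mem_head.
have nz1: red z1 != 0.
  have [k p'k z1k] := p'z1; apply/eqP=> z10.
  have := congr1 red z1k; rewrite rmorph1 rmorphXn z10 /= expr0n.
  case: k p'k {z1k} => [|k _ /esym/eqP]; first by rewrite dvdn0.
  by rewrite oner_eq0.
have val_mul (z : algint) : (z1 : algC) * (z : algC) = (z1 * z : algint) by [].
under eq_bigr do rewrite val_mul.
rewrite -(big_map (fun z => z1 * z) xpredT (fun z : algint => z : algC)).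
apply: (p'_roots_sum_eq p_prime p_char (red := red)) => //.
  move=> _ /mapP[z /p's[k p'k zk] ->]; have [l p'l z1l] := p'z1.
  exists (l * k)%N; first by rewrite Euclid_dvdM // negb_or p'l.
  by rewrite exprMn exprM z1l expr1n mul1r mulnC exprM zk expr1n.
rewrite -def_s -(eq_char g Gg) big_map.
move: tr1; rewrite big_seq1 trace_mx11 => ->.
rewrite (@char_poly_scale _ _ _ _ (map red s)) ?big_map //.
by apply: eq_bigr => z _; rewrite rmorphM.
Qed.

(** Here B is a nonzero homomorphism from the module of rS to End(V), with V the
    module of rG. Only a linear rS can occur, and twisting by it fixes eta. *)
Lemma cent_twist_trivial m n k (rS : mx_representation F (G / N) m)
    (rG : mx_representation F G n) (rW : mx_representation F G k) beta eta
    (B : 'M_(m, n * n)) :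
    (0 < m)%N -> mx_irreducible rG ->
    affords_Brauer p red rS beta -> affords_Brauer p red rG eta ->
    mx_irreducible rW -> affords_Brauer p red rW ((beta %% N)%CF * eta) ->
    B != 0 ->
    {in G, forall g, rS (coset N g) *m B = B *m conj_repr rG g} ->
  m = 1%N /\ (beta %% N)%CF * eta = eta.
Proof.
move=> m_gt0 irrG aff_beta aff_eta irrW affW nzB homB.
have [n_gt0 simG] := (mx_irrP rG).1 irrG.
have absT := tens_Brauer_abs_irr aff_beta aff_eta irrW affW.
have freeP: row_free (eval_mx B).
  apply: (irr_hom_row_free (mx_abs_irrW absT) (eval_mx_neq0 nzB)) => g Gg.
  by apply: eval_mx_hom => //; apply: homB.
(* Evaluation is an injection from F^(m * n) to F^n. *)
have m1: m = 1%N.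
  apply/eqP; rewrite eqn_leq m_gt0 andbT -(leq_pmul2r n_gt0) mul1n.
  by rewrite -{1}(eqP freeP) rank_leq_col.
split=> //; move: rS B aff_beta nzB homB {absT freeP m_gt0}.
rewrite m1 => rS B aff_beta nzB homB.
(* M is a nonzero homomorphism from the twist of V by rS to V. *)
pose M := vec_mx (row 0 B).
have def_B : B = mxvec M by apply/rowP=> j; rewrite vec_mxK mxE.
have homM g : g \in G -> (rS (coset N g) 0 0 *: rG g) *m M = M *m rG g.
  move=> Gg; have eqM: rS (coset N g) 0 0 *: M = rG g^-1%g *m M *m rG g.
    apply: (can_inj mxvecK); rewrite linearZ /= -mul_vec_conj_repr -def_B.
    by rewrite -homB // [in RHS](mx11_scalar (rS _)) mul_scalar_mx.
  rewrite -scalemxAl scalemxAr eqM.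
  by rewrite !mulmxA -repr_mxM ?groupV // mulgV repr_mx1 mul1mx.
have uM: M \in unitmx.
  rewrite -row_free_unit -kermx_eq0; apply: contraNT nzB => nz_ker.
  rewrite def_B; suffices ->: M = 0 by rewrite linear0.
  rewrite -[M]mul1mx; apply/sub_kermxP; rewrite sub1mx.
  apply: simG nz_ker; apply/mxmoduleP=> g Gg; apply/sub_kermxP.
  have Qg : coset N g \in (G / N)%g by apply: mem_quotient.
  have nz_c: rS (coset N g) 0 0 != 0.
    have := repr_mx_unit rS Qg; rewrite unitmxE [rS _]mx11_scalar det_scalar1.
    by rewrite unitfE mxE eqxx mulr1n.
  apply: (scalerI nz_c); rewrite scaler0 -mulmxA scalemxAr scalemxAl homM //.
  by rewrite mulmxA mulmx_ker mul0mx.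
apply: linear_scale_affords aff_beta aff_eta _ => g Gg.
exact: char_poly_intertwine uM (homM g Gg).
Qed.

End InflatedTensor.

Theorem theorem2 (p : nat) (p_prime : prime p)
    (F : closedFieldType) (p_char : p \in [pchar F])
    (red : {rmorphism algint -> F})
    (red_surj : forall a : F, exists z : algint, red z = a)
    (gT : finGroupType) (G N : {group gT}) (nsNG : N <| G)
    (eta : 'CF(G)) (eta_IBr : IBr p red G eta)
    (n : nat) (beta : 'I_n -> 'CF(G / N)) (beta_inj : injective beta)
    (beta_IBr : forall phi : 'CF(G / N),
       IBr p red (G / N) phi <-> exists i, phi = beta i)
    (p'GN : ~~ (p %| #|(G / N)%g|)%N)
    (beta_eta_inj : injective (fun i => (beta i %% N)%CF * eta))
    (beta_eta_IBr : forall i, IBr p red G ((beta i %% N)%CF * eta)) :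
  IBr p red N ('Res[N] eta).
Proof.
have [d [rG [irrG affG]]] := eta_IBr; have [sNG nNG] := andP nsNG.
have p'Q: p^'.-group (G / N)%G by rewrite /pgroup p'natE.
exists d, (subg_repr rG (normal_sub nsNG)); split; last first.
  move=> g Ng; have Gg := subsetP sNG g Ng.
  by rewrite cfResE //; apply: affG.
apply: (Clifford_cent_scalar_irr irrG) => A cNA.
(* E = End_N(V) is the space of N-fixed vectors of the conjugation module. *)
pose modE := normal_rfix_mx_module (conj_repr rG) nsNG.
pose rE := submod_repr modE.
have kerE: N \subset rker rE by rewrite rker_submod rfix_mx_rstabC.
pose rQ := quo_repr kerE nNG.
(* Q acts trivially on E. *)
have fixQ: (1%:M <= rfix_mx rQ (G / N)%g)%MS.
  have redQ: mx_completely_reducible rQ 1%:M.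
    apply: mx_Maschke_pchar; rewrite (eq_pgroup _ (eq_negn (pcharf_eq p_char))).
    exact: p'Q.
  have [W modW defW dxW] := redQ _ (rfix_mx_module rQ) (submx1 _).
  rewrite -defW addsmx_sub submx_refl /=; have [-> | nzW] := eqVneq W 0.
    exact: sub0mx.
  (* A nonzero complement W of the fixed vectors contains a simple module U. *)
  apply: (mxsimple_exists modW nzW) => [[U simU sUW]].
  have modU := mxsimple_module simU; have [_ nzU _] := simU.
  pose rS := submod_repr modU.
  have irrS: mx_irreducible rS by apply/submod_mx_irr.
  have [phi aff_phi]: exists phi, affords_Brauer p red rS phi.
    exact: affords_Brauer_exists.
  have [|i def_phi] := (beta_IBr phi).1; first by exists _, rS.
  have [|i1 def_1] := (beta_IBr 1).1; first exact: IBr_cfun1.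
  have [k [rW [irrW affW]]] := beta_eta_IBr i; rewrite -def_phi in affW.
  pose B := val_submod (val_submod (1%:M : 'M_(\rank U))).
  have homB: {in G, forall g, rS (coset N g) *m B = B *m conj_repr rG g}.
    move=> g Gg; have Qg : coset N g \in (G / N)%g by apply: mem_quotient.
    rewrite -val_submodJ // -[rE g](quo_repr_coset kerE nNG Gg) -val_submodJ //.
    rewrite mul1mx [RHS]val_submodE [val_submod (submod_mx _ _)]val_submodE.
    by rewrite -mulmxA /B (val_submodE (val_submod _)).
  have nzB: B != 0 by rewrite !val_submod_eq0 -mxrank_eq0 mxrank1 mxrank_eq0.
  have m_gt0: (0 < \rank U)%N by rewrite lt0n mxrank_eq0.
  have [m1 phi_eta] := cent_twist_trivial p_prime p_char nsNG m_gt0 irrG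
    aff_phi affG irrW affW nzB homB.
  have def_i: i = i1.
    by apply: beta_eta_inj; rewrite -def_phi phi_eta -def_1 rmorph1 mul1r.
  have trivS x : x \in (G / N)%g -> rS x = 1%:M.
    move: aff_phi; rewrite def_phi def_i -def_1.
    move: (rS) m1; move: (\rank U) => m r m1; rewrite m1 in r *.
    move=> aff_r Qx.
    exact: affords_cfun1_trivial aff_r Qx (mem_p_elt p'Q Qx).
  have sUfix: (U <= rfix_mx rQ (G / N)%g)%MS.
    rewrite -(val_submod1 U); apply/rfix_mxP=> x Qx.
    by rewrite -val_submodJ // mul1mx trivS.
  case/negP: nzU; rewrite -submx0 -(mxdirect_addsP dxW).
  by rewrite sub_capmx sUfix.
apply: (closed_cent_scalar irrG); apply/centgmxP=> g Gg.
apply/(mxvec_conj_fixP rG A Gg).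
have sAE: (mxvec A <= rfix_mx (conj_repr rG) N)%MS.
  apply/rfix_mxP=> x Nx; apply/mxvec_conj_fixP; first exact: (subsetP sNG).
  by rewrite (centgmxP cNA).
rewrite -(in_submodK sAE) -val_submodJ //; congr (val_submod _).
rewrite -[submod_repr _ g](quo_repr_coset kerE nNG Gg).
have /rfix_mxP-> // := submx_trans (submx1 (in_submod _ (mxvec A))) fixQ.
exact: mem_quotient.
Qed.
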